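(* Let $\Lambda$ be an isometry invariant finite Borel measure on $\mathcal{C}^d$ with $\gamma=\Lambda(\mathcal{C}^d)\in(0,\infty)$, and let $c_s:\mathcal{C}^d\to\mathbb{S}^d\cup\{o\}$ be a centre function. There exists a unique probability measure $\mathbb{Q}$ on $\mathcal{C}^d$, concentrated on $\mathcal{C}^d_o\cup\mathcal{C}^d_{\mathsf p}$, such that the restriction of $\mathbb{Q}$ to $\mathcal{C}^d_o$ is rotation invariant, the restriction of $\mathbb{Q}$ to $\mathcal{C}^d_{\mathsf p}$ is invariant under rotations fixing $\mathsf p$, and $\mathbb{Q}$ satisfies $$\Lambda=\gamma\int_{\mathcal{C}^d}\int_{\mathrm{SO}(d+1)}\mathbf 1\{\varrho C\in\cdot\}\,\lambda(d\varrho)\,\mathbb{Q}(dC).$$ This measure is given by $$\mathbb{Q}=\frac1\gamma\int_{\mathcal{C}^d}\int_{\mathrm{SO}(d+1)}\mathbf 1\{\varrho^{-1}C\in\cdot\}\,\kappa(c_s(C),d\varrho)\,\Lambda(dC).$$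
   Context: $\mathbb{S}^d$ is the unit sphere in $\mathbb{R}^{d+1}$ ($d\ge2$), $o$ is the zero vector of $\mathbb{R}^{d+1}$, $\mathsf p\in\mathbb{S}^d$ is a fixed point, and $\lambda$ is the Haar probability measure on the rotation (isometry) group $\mathrm{SO}(d+1)$. $\mathcal{C}^d$ is the space of nonempty compact subsets of $\mathbb{S}^d$ with the topology of the Hausdorff metric; $\Lambda$ is isometry invariant if $\Lambda(\varrho A)=\Lambda(A)$ for all $\varrho\in\mathrm{SO}(d+1)$ and Borel $A\subset\mathcal{C}^d$, where $\varrho A=\{\varrho C:C\in A\}$. A centre function is a measurable map $c_s:\mathcal{C}^d\to\mathbb{S}^d\cup\{o\}$ with $c_s(\varrho C)=\varrho c_s(C)$ for $C\in\mathcal{C}^d$, $\varrho\in\mathrm{SO}(d+1)$. For $z\in\{o,\mathsf p\}$, $\mathcal{C}^d_z=\{C\in\mathcal{C}^d:c_s(C)=z\}$. The probability kernel $\kappa$ from $\mathbb{S}^d\cup\{o\}$ to $\mathrm{SO}(d+1)$: $\kappa(\mathsf p,\cdot)$ is the unique invariant probability measure on the stabilizer $\{\varrho:\varrho\mathsf p=\mathsf p\}$ (regarded as a measure on $\mathrm{SO}(d+1)$); for $x\in\mathbb{S}^d$ and any rotation $\varrho_x$ with $\varrho_x\mathsf p=x$, $\kappa(x,B)=\int\mathbf 1\{\varrho_x\circ\varrho\in B\}\,\kappa(\mathsf p,d\varrho)$ (independent of the choice of $\varrho_x$); and $\kappa(o,\cdot)=\lambda$. *)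

(* Defs.v *)
From HB Require Import structures.
From mathcomp Require Import all_boot all_order all_algebra.
From mathcomp Require Import all_classical all_reals all_analysis.
From mathcomp Require Import ring lra.

Set Implicit Arguments.
Unset Strict Implicit.
Unset Printing Implicit Defensive.
Import Order.TTheory GRing.Theory Num.Theory.
Import numFieldNormedType.Exports.
Local Open Scope classical_set_scope.
Local Open Scope ring_scope.

Definition in_set_type T (A : set T) (x : T) (Ax : x \in A) : set_type A :=
  exist _ x Ax.

(** ** The Euclidean distance *)

(* The library norm on 'cV[R]_n is the sup norm; it induces the topology used
   below, but it is not rotation invariant. *)
Definition eucl_norm (R : realType) n (x : 'cV[R]_n) : R :=
  Num.sqrt (\sum_(i < n) (x i 0) ^+ 2).

Definition eucl_dist (R : realType) n (x y : 'cV[R]_n) : R := eucl_norm (x - y).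

Section euclidean_facts.
Context {R : realType} {n : nat}.
Implicit Types x y z : 'cV[R]_n.

Lemma sumsq_ge0 x : 0 <= \sum_(i < n) (x i 0) ^+ 2.
Proof. by apply: sumr_ge0 => i _; exact: sqr_ge0. Qed.

Lemma eucl_norm_ge0 x : 0 <= eucl_norm x.
Proof. exact: sqrtr_ge0. Qed.

Lemma eucl_norm_sqr x : eucl_norm x ^+ 2 = \sum_(i < n) (x i 0) ^+ 2.
Proof. by rewrite sqr_sqrtr ?sumsq_ge0. Qed.

Lemma eucl_norm0 : eucl_norm (0 : 'cV[R]_n) = 0.
Proof.
by rewrite /eucl_norm big1 ?sqrtr0// => i _; rewrite mxE expr0n.
Qed.

Lemma eucl_normN x : eucl_norm (- x) = eucl_norm x.
Proof. by rewrite /eucl_norm; under eq_bigr do rewrite mxE sqrrN. Qed.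

Lemma le_coord_eucl_norm x i : `|x i 0| <= eucl_norm x.
Proof.
rewrite -sqrtr_sqr ler_wsqrtr// (bigD1 i)//= lerDl.
by apply: sumr_ge0 => j _; exact: sqr_ge0.
Qed.

Lemma eucl_norm_eq0 x : eucl_norm x = 0 -> x = 0.
Proof.
move=> x0; apply/colP => i; rewrite mxE; apply/eqP; rewrite -normr_le0 -x0.
exact: le_coord_eucl_norm.
Qed.

Lemma cauchy_schwarz x y : \sum_(i < n) x i 0 * y i 0 <= eucl_norm x * eucl_norm y.
Proof.
have [x0|x0] := eqVneq (eucl_norm x) 0.
  rewrite (eucl_norm_eq0 x0) eucl_norm0 mul0r big1// => i _.
  by rewrite mxE mul0r.
have [y0|y0] := eqVneq (eucl_norm y) 0.
  rewrite (eucl_norm_eq0 y0) eucl_norm0 mulr0 big1// => i _.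
  by rewrite mxE mulr0.
set p := \sum_(i < n) _; set a := eucl_norm x; set b := eucl_norm y.
have a0 : 0 < a by rewrite lt_neqAle eq_sym x0 eucl_norm_ge0.
have b0 : 0 < b by rewrite lt_neqAle eq_sym y0 eucl_norm_ge0.
have := sumsq_ge0 (b *: x - a *: y).
have -> : \sum_(i < n) ((b *: x - a *: y) i 0) ^+ 2 =
    b ^+ 2 * a ^+ 2 + a ^+ 2 * b ^+ 2 - 2 * (a * b) * p.
  rewrite [X in b ^+ 2 * X](eucl_norm_sqr x) [X in a ^+ 2 * X](eucl_norm_sqr y).
  rewrite /p !mulr_sumr -big_split/= -sumrB; apply: eq_bigr => i _.
  by rewrite !mxE; ring.
have -> : b ^+ 2 * a ^+ 2 + a ^+ 2 * b ^+ 2 - 2 * (a * b) * p =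
    2 * (a * b) * (a * b - p) by ring.
by rewrite pmulr_rge0 ?subr_ge0// !mulr_gt0.
Qed.

Lemma eucl_normD x y : eucl_norm (x + y) <= eucl_norm x + eucl_norm y.
Proof.
rewrite -(@ler_pXn2r _ 2)// ?nnegrE ?addr_ge0 ?eucl_norm_ge0//.
rewrite eucl_norm_sqr sqrrD !eucl_norm_sqr.
under eq_bigr do rewrite mxE sqrrD.
rewrite !big_split/= lerD2r lerD2l mulr2n.
by rewrite lerD// cauchy_schwarz.
Qed.

Lemma eucl_dist_ge0 x y : 0 <= eucl_dist x y.
Proof. exact: eucl_norm_ge0. Qed.

Lemma eucl_distxx x : eucl_dist x x = 0.
Proof. by rewrite /eucl_dist subrr eucl_norm0. Qed.

Lemma eucl_distC x y : eucl_dist x y = eucl_dist y x.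
Proof. by rewrite /eucl_dist -eucl_normN opprB. Qed.

Lemma eucl_dist_triangle y x z : eucl_dist x z <= eucl_dist x y + eucl_dist y z.
Proof. by rewrite /eucl_dist -[X in eucl_norm X](subrKA y) eucl_normD. Qed.

End euclidean_facts.

(** ** The unit sphere and the space of centres *)

Definition sphere (R : realType) (d : nat) : set 'cV[R]_d.+1 :=
  [set x | eucl_norm x = 1].

(* S^d \cup {o} inside R^{d+1}, with the subspace topology. *)
Definition sphereo (R : realType) (d : nat) : Type :=
  set_type (@sphere R d `|` [set 0]).

Section sphereo_instances.
Context (R : realType) (d : nat).

Lemma sphereo0_subproof : (0 : 'cV[R]_d.+1) \in (@sphere R d `|` [set 0]).
Proof. by apply/mem_set; right. Qed.

HB.instance Definition _ :=
  Topological.copy (sphereo R d) (set_type (@sphere R d `|` [set 0])).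
HB.instance Definition _ :=
  isPointed.Build (sphereo R d) (in_set_type sphereo0_subproof).
HB.instance Definition _ :=
  Measurable.copy (sphereo R d) (g_sigma_algebraType (@open (sphereo R d))).

End sphereo_instances.

Definition vec (R : realType) (d : nat) (x : sphereo R d) : 'cV[R]_d.+1 :=
  \val x.

Definition origin (R : realType) (d : nat) : sphereo R d := point.

Lemma vec_origin (R : realType) (d : nat) : vec (origin R d) = 0.
Proof. by []. Qed.

(** ** The rotation group SO(d+1) *)

Definition is_rotation (R : realType) (d : nat) : set 'M[R]_d.+1 :=
  [set A | A^T *m A = 1%:M /\ \det A = 1].

(* [SO R d] is SO(d+1), with the subspace topology of the matrix space. *)
Definition SO (R : realType) (d : nat) : Type := set_type (@is_rotation R d).

Definition rmx (R : realType) (d : nat) (r : SO R d) : 'M[R]_d.+1 := \val r.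

Section SO_instances.
Context (R : realType) (d : nat).
Implicit Types r s t : SO R d.

Lemma SO_inj : injective (@rmx R d).
Proof. exact: val_inj. Qed.

Lemma rmxP r : is_rotation (rmx r).
Proof. exact: set_mem (valP r). Qed.

Lemma SO1_subproof : (1%:M : 'M[R]_d.+1) \in @is_rotation R d.
Proof. by apply/mem_set; split; rewrite ?trmx1 ?mulmx1 ?det1. Qed.

Lemma SOM_subproof r s : rmx r *m rmx s \in @is_rotation R d.
Proof.
apply/mem_set; have [rr dr] := rmxP r; have [ss ds] := rmxP s; split.
  by rewrite trmx_mul -mulmxA (mulmxA _^T (rmx r)) rr mul1mx.
by rewrite det_mulmx dr ds mulr1.
Qed.

Lemma SOV_subproof r : (rmx r)^T \in @is_rotation R d.
Proof.
apply/mem_set; have [rr dr] := rmxP r; split; last by rewrite det_tr.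
by rewrite trmxK; exact: mulmx1C.
Qed.

Definition SO1 : SO R d := in_set_type SO1_subproof.
Definition SOM r s : SO R d := in_set_type (SOM_subproof r s).
Definition SOV r : SO R d := in_set_type (SOV_subproof r).

Lemma SOA : associative SOM.
Proof. by move=> r s t; apply: SO_inj; exact: mulmxA. Qed.

Lemma SO1M : left_id SO1 SOM.
Proof. by move=> r; apply: SO_inj; exact: mul1mx. Qed.

Lemma SOM1 : right_id SO1 SOM.
Proof. by move=> r; apply: SO_inj; exact: mulmx1. Qed.

Lemma SOVM : left_inverse SO1 SOV SOM.
Proof. by move=> r; apply: SO_inj; case: (rmxP r). Qed.

Lemma SOMV : right_inverse SO1 SOV SOM.
Proof. by move=> r; apply: SO_inj; apply: mulmx1C; case: (rmxP r). Qed.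

HB.instance Definition _ :=
  Topological.copy (SO R d) (set_type (@is_rotation R d)).
HB.instance Definition _ := isGroup.Build (SO R d) SOA SO1M SOM1 SOVM SOMV.
HB.instance Definition _ := isPointed.Build (SO R d) SO1.
HB.instance Definition _ :=
  Measurable.copy (SO R d) (g_sigma_algebraType (@open (SO R d))).

Lemma eucl_norm_rot r (x : 'cV[R]_d.+1) : eucl_norm (rmx r *m x) = eucl_norm x.
Proof.
have sumE (y : 'cV[R]_d.+1) : \sum_i (y i 0) ^+ 2 = (y^T *m y) 0 0.
  by rewrite mxE; apply: eq_bigr => i _; rewrite mxE expr2.
rewrite /eucl_norm !sumE trmx_mul -mulmxA (mulmxA _^T (rmx r)).
by have [-> _] := rmxP r; rewrite mul1mx.
Qed.

Lemma rot_pt_subproof r (x : sphereo R d) :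
  rmx r *m vec x \in (@sphere R d `|` [set 0]).
Proof.
apply/mem_set; have [xS|/= x0] := set_mem (valP x).
  by left; rewrite /sphere/= eucl_norm_rot.
by right; rewrite /= [vec x]x0 mulmx0.
Qed.

Definition rot_pt r (x : sphereo R d) : sphereo R d :=
  in_set_type (rot_pt_subproof r x).

End SO_instances.

(** ** Nonempty compact subsets of the sphere, with the Hausdorff metric *)

Definition compact_in_sphere (R : realType) (d : nat) :
    set (set 'cV[R]_d.+1) :=
  [set C | [/\ C !=set0, compact C & C `<=` @sphere R d]].

Definition Cd (R : realType) (d : nat) : Type :=
  set_type (@compact_in_sphere R d).

Definition carrier (R : realType) (d : nat) (C : Cd R d) : set 'cV[R]_d.+1 :=
  \val C.

Definition dist_to (R : realType) n (x : 'cV[R]_n) (D : set 'cV[R]_n) : R :=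
  inf [set eucl_dist x y | y in D].

Definition hausdorff_dist (R : realType) (d : nat) (C D : Cd R d) : R :=
  Num.max (sup [set dist_to x (carrier D) | x in carrier C])
          (sup [set dist_to y (carrier C) | y in carrier D]).

Section Cd_instances.
Context (R : realType) (d : nat).
Implicit Types (C D E : Cd R d) (x y : 'cV[R]_d.+1).

Lemma carrierP C : compact_in_sphere (carrier C).
Proof. exact: set_mem (valP C). Qed.

Lemma carrier_inj : injective (@carrier R d).
Proof. exact: val_inj. Qed.

Lemma dist_to_le x D y : carrier D y -> dist_to x (carrier D) <= eucl_dist x y.
Proof.
move=> Dy; apply: ge_inf; last by exists y.
by exists 0 => _ [z _ <-]; exact: eucl_dist_ge0.
Qed.

Lemma dist_to_ge x D m : (forall y, carrier D y -> m <= eucl_dist x y) ->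
  m <= dist_to x (carrier D).
Proof.
move=> mD; apply: lb_le_inf; last by move=> _ [y Dy <-]; exact: mD.
by have [[y Dy] _ _] := carrierP D; exists (eucl_dist x y), y.
Qed.

Lemma dist_to_ge0 x D : 0 <= dist_to x (carrier D).
Proof. by apply: dist_to_ge => y _; exact: eucl_dist_ge0. Qed.

Lemma eucl_dist_sphere x y : sphere x -> sphere y -> eucl_dist x y <= 2.
Proof.
move=> xS yS; rewrite /eucl_dist (le_trans (eucl_normD _ _))// eucl_normN xS yS.
by rewrite -natr1.
Qed.

Lemma sup_dist_to_le C D x : carrier C x ->
  dist_to x (carrier D) <= sup [set dist_to z (carrier D) | z in carrier C].
Proof.
move=> Cx; apply: ub_le_sup; last by exists x.
exists 2 => _ [z Cz <-]; have [[y Dy] _ DS] := carrierP D.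
have [_ _ CS] := carrierP C.
by apply: le_trans (dist_to_le z Dy) _; apply: eucl_dist_sphere; [exact: CS|exact: DS].
Qed.

Lemma sup_dist_to_ge C D m :
  (forall x, carrier C x -> dist_to x (carrier D) <= m) ->
  sup [set dist_to z (carrier D) | z in carrier C] <= m.
Proof.
move=> mC; apply: ge_sup; last by move=> _ [x Cx <-]; exact: mC.
by have [[x Cx] _ _] := carrierP C; exists (dist_to x (carrier D)), x.
Qed.

Lemma dist_to_self x C : carrier C x -> dist_to x (carrier C) = 0.
Proof.
move=> Cx; apply/eqP; rewrite eq_le dist_to_ge0 andbT -(eucl_distxx x).
exact: dist_to_le.
Qed.

Lemma dist_to_eq0 x C : dist_to x (carrier C) = 0 -> carrier C x.
Proof.
move=> xC; have [_ cC _] := carrierP C.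
have /closure_id -> : closed (carrier C).
  exact: (compact_closed (@norm_hausdorff _ _) cC).
move=> B /nbhs_ballP[e /= e0 eB].
have hi : has_inf [set eucl_dist x y | y in carrier C].
  split; last by exists 0 => _ [z _ <-]; exact: eucl_dist_ge0.
  by have [[y Cy] _ _] := carrierP C; exists (eucl_dist x y), y.
have [_ [y Cy <-]] := inf_adherent e0 hi.
rewrite -/(dist_to x (carrier C)) xC add0r => xye.
exists y; split => //; apply: eB; split => // i j.
rewrite /ball/= (le_lt_trans _ xye)// ord1.
by have := le_coord_eucl_norm (x - y) i; rewrite !mxE.
Qed.

Lemma hausdorff_distxx C : hausdorff_dist C C = 0.
Proof.
rewrite /hausdorff_dist maxxx; apply/eqP; rewrite eq_le; apply/andP; split.
  by apply: sup_dist_to_ge => x Cx; rewrite dist_to_self.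
have [[x Cx] _ _] := carrierP C.
by rewrite (le_trans (dist_to_ge0 x C))// sup_dist_to_le.
Qed.

Lemma hausdorff_distC C D : hausdorff_dist C D = hausdorff_dist D C.
Proof. by rewrite /hausdorff_dist maxC. Qed.

Lemma dist_to_le_hausdorff C D x : carrier C x ->
  dist_to x (carrier D) <= hausdorff_dist C D.
Proof. by move=> Cx; rewrite /hausdorff_dist le_max sup_dist_to_le. Qed.

Lemma hausdorff_dist_eq0 C D : hausdorff_dist C D = 0 -> C = D.
Proof.
have aux E F : hausdorff_dist E F = 0 -> carrier E `<=` carrier F.
  move=> EF x Ex; apply: dist_to_eq0; apply/eqP; rewrite eq_le dist_to_ge0.
  by rewrite andbT -EF dist_to_le_hausdorff.
move=> CD; apply: carrier_inj; apply/seteqP; split; first exact: aux.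
by apply: aux; rewrite hausdorff_distC.
Qed.

Lemma dist_to_triangle C D E x : carrier C x ->
  dist_to x (carrier E) <= hausdorff_dist C D + hausdorff_dist D E.
Proof.
move=> Cx; rewrite -lerBlDr.
apply: le_trans (dist_to_le_hausdorff D Cx); apply: dist_to_ge => y Dy.
rewrite lerBlDr -lerBlDl; apply: le_trans (dist_to_le_hausdorff E Dy).
apply: dist_to_ge => z Ez; rewrite lerBlDl.
exact: le_trans (dist_to_le _ Ez) (eucl_dist_triangle _ _ _).
Qed.

Lemma hausdorff_dist_triangle D C E :
  hausdorff_dist C E <= hausdorff_dist C D + hausdorff_dist D E.
Proof.
rewrite /(hausdorff_dist C E) ge_max; apply/andP; split.
  by apply: sup_dist_to_ge => x; exact: dist_to_triangle.
apply: sup_dist_to_ge => x Ex.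
by rewrite addrC hausdorff_distC (hausdorff_distC C) dist_to_triangle.
Qed.

Lemma Cd_point_subproof :
  [set (delta_mx 0 0 : 'cV[R]_d.+1)] \in @compact_in_sphere R d.
Proof.
apply/mem_set; split; [by exists (delta_mx 0 0)|exact: compact_set1|].
move=> _ ->; rewrite /sphere/= /eucl_norm (bigD1 0)//= mxE !eqxx expr1n big1 ?addr0.
  exact: sqrtr1.
by move=> i i0; rewrite mxE (negbTE i0) expr0n.
Qed.

HB.instance Definition _ := Choice.copy (Cd R d) (set_type (@compact_in_sphere R d)).
HB.instance Definition _ := isMetric.Build R (Cd R d)
  hausdorff_distxx hausdorff_dist_eq0 hausdorff_distC hausdorff_dist_triangle.
HB.instance Definition _ :=
  isPointed.Build (Cd R d) (in_set_type Cd_point_subproof).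
HB.instance Definition _ :=
  Measurable.copy (Cd R d) (g_sigma_algebraType (@open (Cd R d))).

Lemma mulmx_continuous (A : 'M[R]_d.+1) :
  continuous (fun x : 'cV[R]_d.+1 => A *m x).
Proof.
move=> x P [Q Qx QP].
suff : \forall y \near x, forall i j, Q i j ((A *m y) i j).
  by apply: filterS => y; exact: QP.
apply: (@filter_forall _ _ (fun i y => forall j, Q i j ((A *m y) i j))
  (nbhs x) (nbhs_filter x)) => i.
apply: (@filter_forall _ _ (fun j y => Q i j ((A *m y) i j))
  (nbhs x) (nbhs_filter x)) => j.
suff : (fun y : 'cV[R]_d.+1 => (A *m y) i j) @ x --> (A *m x) i j.
  by move=> /(_ _ (Qx i j)).
have -> : (fun y : 'cV[R]_d.+1 => (A *m y) i j) =
    \sum_k (fun y : 'cV[R]_d.+1 => A i k * y k j).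
  by apply/funext => y; rewrite fct_sumE mxE.
rewrite mxE; elim/big_ind2 : _ => [|a f b g fa gb|k _].
- exact: (@cvg_cst _ (0 : R) _ (nbhs x) (nbhs_filter x)).
- exact: (@cvgD _ _ _ _ (nbhs_filter x) f g a b fa gb).
- apply: (@cvgMl_tmp _ _ (nbhs x) (nbhs_filter x)).
  exact: coord_continuous.
Qed.

Lemma rot_subproof (r : SO R d) C :
  (fun x => rmx r *m x) @` carrier C \in @compact_in_sphere R d.
Proof.
apply/mem_set; have [[x Cx] cC CS] := carrierP C; split.
- by exists (rmx r *m x), x.
- apply: continuous_compact cC.
  exact/continuous_subspaceT/mulmx_continuous.
- by move=> _ [y Cy <-]; rewrite /sphere/= eucl_norm_rot; exact: CS.
Qed.

Definition rot_set (r : SO R d) C : Cd R d := in_set_type (rot_subproof r C).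

End Cd_instances.

(** ** Invariance, Haar measure, the kernel kappa, centre functions *)

Definition left_invariant (R : realType) (d : nat) (G : set (SO R d))
    (mu : set (SO R d) -> \bar R) : Prop :=
  forall r : SO R d, G r -> forall B : set (SO R d), measurable B ->
    mu [set (r * s)%g | s in B] = mu B.

Definition is_haar (R : realType) (d : nat)
    (lambda : probability (SO R d) R) : Prop :=
  left_invariant setT lambda.

Definition stabilizer (R : realType) (d : nat) (x : sphereo R d) :
    set (SO R d) :=
  [set r | rot_pt r x = x].

(* The invariant probability measure on the stabilizer of [p], seen as a
   measure on SO(d+1). *)
Definition is_stabilizer_haar (R : realType) (d : nat) (p : sphereo R d)
    (nu : set (SO R d) -> \bar R) : Prop :=
  nu (stabilizer p) = 1%E /\ left_invariant (stabilizer p) nu.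

(* The invariant probability measure on the compact group [stabilizer p] and
   the Haar measure are unique, so these conditions determine kappa x B for all
   x and all Borel sets B. *)
Definition is_kappa (R : realType) (d : nat) (p : sphereo R d)
    (lambda : probability (SO R d) R)
    (kappa : R.-pker (sphereo R d) ~> (SO R d)) : Prop :=
  [/\ is_stabilizer_haar p (kappa p),
      forall (x : sphereo R d) (rx : SO R d), sphere (vec x) ->
        rot_pt rx p = x -> forall B : set (SO R d), measurable B ->
        kappa x B = (\int[kappa p]_r (\1_B (rx * r)%g)%:E)%E
    & forall B : set (SO R d), measurable B ->
        kappa (origin R d) B = lambda B].

Definition rot_invariant (R : realType) (d : nat) (G : set (SO R d))
    (nu : set (Cd R d) -> \bar R) : Prop :=
  forall r : SO R d, G r -> forall A : set (Cd R d), measurable A ->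
    nu [set rot_set r C | C in A] = nu A.

Definition centre_function (R : realType) (d : nat)
    (cs : Cd R d -> sphereo R d) : Prop :=
  measurable_fun setT cs /\
  forall (r : SO R d) (C : Cd R d), cs (rot_set r C) = rot_pt r (cs C).

Definition Cd_at (R : realType) (d : nat) (cs : Cd R d -> sphereo R d)
    (z : sphereo R d) : set (Cd R d) :=
  [set C | cs C = z].

Definition restriction (R : realType) T (nu : set T -> \bar R) (D : set T) :
    set T -> \bar R :=
  fun A => nu (A `&` D).

Definition is_centred_shape (R : realType) (d : nat) (p : sphereo R d)
    (lambda : probability (SO R d) R) (cs : Cd R d -> sphereo R d)
    (Lambda : set (Cd R d) -> \bar R) (gamma : R)
    (Q : probability (Cd R d) R) : Prop :=
  [/\ Q (~` (Cd_at cs (origin R d) `|` Cd_at cs p)) = 0%E,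
      rot_invariant setT (restriction Q (Cd_at cs (origin R d))),
      rot_invariant (stabilizer p) (restriction Q (Cd_at cs p))
    & forall A : set (Cd R d), measurable A ->
        Lambda A =
        (gamma%:E * \int[Q]_C \int[lambda]_r (\1_A (rot_set r C))%:E)%E].

(* Main.v *)
(* Put P = Lambda / gamma, let [centring C] be the law of r^-1 C for r
   distributed according to kappa (cs C), and [spread lambda C] the law of r C
   for r distributed according to lambda; Q is the mixture of the laws
   [centring C] over P.  Left invariant probabilities on a group are right
   invariant, hence spread (r^-1 C) = spread C, and averaging over Q gives back
   the average of [spread C] over P, which is P by Fubini and invariance.  Right
   invariance of kappa p gives the invariance of Q on {cs = p}.

   If Q' also represents P, then on {cs = o} both Q and Q' agree with P.  On
   {cs = p}, substitute P = int spread C Q'(dC) in the definition of Q: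
   kappa (s p) is the image of kappa p under r |-> s r, so the rotation s by
   which C was spread cancels, and Q(A) is the average of Q'(r A) for r
   distributed according to kappa p, that is Q'(A).

   The integrals make sense since SO(d+1) is second countable: continuous maps
   on SO(d+1) x X are then measurable for the product of the Borel
   sigma-algebras, whatever the space X. *)

Require Import Defs.
From HB Require Import structures.
From mathcomp Require Import all_boot all_order all_algebra.
From mathcomp Require Import all_classical all_reals all_analysis.
From mathcomp Require Import measurable_realfun ring lra.

Set Implicit Arguments.
Unset Strict Implicit.
Unset Printing Implicit Defensive.
Import Order.TTheory GRing.Theory Num.Theory.
Import numFieldNormedType.Exports.
Local Open Scope classical_set_scope.
Local Open Scope ring_scope.

(** * Measurability of continuous maps on SO(d+1) x X *)

(** Only the first sides have to range over a countable family: for each base set [U] of [S], all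
    open [W] with [U x W] inside [O] are merged into the single open set [V U]. *)
Lemma open_prod_measurable (S X : ptopologicalType) (O : set (S * X)) :
  @second_countable S -> open O ->
  measurable (O : set (g_sigma_algebraType (@open S) *
                       g_sigma_algebraType (@open X))).
Proof.
move=> [B cB [Bo Bb]] oO.
pose V (U : set S) := \bigcup_(W in [set W : set X | open W /\ U `*` W `<=` O]) W.
have -> : O = \bigcup_(U in B) (U `*` V U).
  apply/seteqP; split => [[s x] Osx|[s x] [U BU] [/= Us [W [oW UWO] Wx]]]; last first.
    exact: UWO.
  have [[P Q] /= [Ps Qx] PQO] : nbhs (s, x) O by exact: open_nbhs_nbhs.
  have [U [BU Us] UP] := Bb s _ Ps.
  move: Qx; rewrite nbhsE => -[W [oW Wx] WQ].
  exists U => //; split => //; exists W => //; split => // -[s' x'] [/= Us' Wx'].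
  by apply: PQO; split; [exact: UP|exact: WQ].
rewrite bigcup_set_type.
apply: countable_bigcupT_measurable => [|[U /= /set_mem BU]].
  by rewrite (eq_countable (card_setT _)).
apply: measurableX; apply: sub_sigma_algebra; first exact: Bo.
by apply: bigcup_open => W [].
Qed.

(* The rational matrices are dense, so the traces of the balls of radius 1/k
   around them form a base. *)
Lemma SO_second_countable (R : realType) (d : nat) :
  @second_countable (SO R d).
Proof.
pose b (qk : 'M[rat]_d.+1 * nat) : set (SO R d) :=
  [set r | ball (map_mx ratr qk.1 : 'M[R]_d.+1) (qk.2.+1%:R^-1) (rmx r)].
exists (range b); first exact: card_le_trans (card_image_le _ _) (countableP _).
split=> [_ [[q k] _ <-]|r A].
  exists (ball (map_mx ratr q : 'M[R]_d.+1) k.+1%:R^-1) => //.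
  exact: ball_open.
move=> [_ [[W oW <-] Wr WA]].
have /nbhs_ballP[e /= e0 eW] : nbhs (rmx r) W by exact: open_nbhs_nbhs.
(* With radius [1/(k+1) < e/2], a ball around a rational matrix that contains [r] lies in the ball
   of radius [e] around [r]. *)
have [k ke] : exists k, k.+1%:R^-1 < e / 2 :> R.
  by have [k] := ltr_add_invr (divr_gt0 e0 (ltr0Sn _ 1)); rewrite add0r; exists k.
have qP i j : exists q : rat, `|ratr q - rmx r i j| < k.+1%:R^-1.
  have : rmx r i j - k.+1%:R^-1 < rmx r i j + k.+1%:R^-1.
    by rewrite ltrD2l gtrN // invr_gt0.
  by move=> /rat_in_itvoo[q]; rewrite in_itv/= -ltr_distl => ?; exists q.
pose q : 'M[rat]_d.+1 := \matrix_(i, j) sval (cid (qP i j)).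
have qr i j : `|ratr (q i j) - rmx r i j| < k.+1%:R^-1.
  by rewrite mxE; case: cid.
exists (b (q, k)).
  split=> /=; first by exists (q, k).
  by split; rewrite ?invr_gt0// => i j; rewrite /ball/= mxE.
move=> s /= [_ qs]; apply: WA; apply: eW; split => // i j.
rewrite /ball/= [e]splitr -(subrKA (ratr (q i j))) (le_lt_trans (ler_normD _ _))//.
rewrite ltrD// (lt_trans _ ke)//; first by rewrite distrC; exact: qr.
by have := qs i j; rewrite /ball/= mxE distrC.
Qed.

Lemma continuous_prod_measurable (S X Y : ptopologicalType) (f : S * X -> Y) :
  @second_countable S -> continuous f ->
  measurable_fun setT (f : g_sigma_algebraType (@open S) *
    g_sigma_algebraType (@open X) -> g_sigma_algebraType (@open Y)).
Proof.
move=> cS /continuousP cf.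
apply: (@measurability _ _
  (g_sigma_algebraType (@open S) * g_sigma_algebraType (@open X))%type
  (g_sigma_algebraType (@open Y))
  setT f (@open Y)) => //.
move=> _ [W oW <-]; rewrite setTI.
by apply: open_prod_measurable => //; exact: cf.
Qed.

Lemma continuous_Borel_measurable (X Y : ptopologicalType) (f : X -> Y) :
  continuous f ->
  measurable_fun setT
    (f : g_sigma_algebraType (@open X) -> g_sigma_algebraType (@open Y)).
Proof.
move=> /continuousP cf.
apply: (@measurability _ _ (g_sigma_algebraType (@open X))
  (g_sigma_algebraType (@open Y)) setT f (@open Y)) => //.
by move=> _ [W oW <-]; rewrite setTI; apply: sub_sigma_algebra; exact: cf.
Qed.

Lemma mx_continuous (T U : topologicalType) m n (f : T -> 'M[U]_(m, n)) :
  (forall i j, continuous (fun x => f x i j)) -> continuous f.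
Proof.
move=> cf x P [Q Qx QP].
suff : \forall y \near x, forall i j, Q i j (f y i j).
  by apply: filterS => y; exact: QP.
apply: (@filter_forall _ _ (fun i y => forall j, Q i j (f y i j))
  (nbhs x) (nbhs_filter x)) => i.
apply: (@filter_forall _ _ (fun j y => Q i j (f y i j))
  (nbhs x) (nbhs_filter x)) => j.
exact: cf (Qx i j).
Qed.

(** * Continuity of the group operations and of the action on compact sets *)

Section rotation_group_topology.
Context {R : realType} {d : nat}.
Implicit Types (r s : SO R d) (C : Cd R d).

Lemma rmx_continuous : continuous (@rmx R d).
Proof. exact: initial_continuous. Qed.

Lemma rmx_entry_continuous i j : continuous (fun r => rmx r i j).
Proof.
move=> r; apply: (@continuous_comp _ _ _ (@rmx R d) (fun A => A i j)).
  exact: rmx_continuous.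
exact: coord_continuous.
Qed.

Lemma SO_continuous (T : topologicalType) (f : T -> SO R d) :
  (forall i j, continuous (fun x => rmx (f x) i j)) -> continuous f.
Proof.
by move=> cf; apply: continuous_comp_initial; apply: mx_continuous.
Qed.

Lemma SOM_continuous : continuous (fun rs : SO R d * SO R d => (rs.1 * rs.2)%g).
Proof.
apply: SO_continuous => i j.
have -> : (fun rs : SO R d * SO R d => rmx (rs.1 * rs.2)%g i j) =
    (fun rs => \sum_k rmx rs.1 i k * rmx rs.2 k j).
  by apply/funext => rs; rewrite [LHS]mxE.
move=> rs; apply: cvg_big => [|k _]; first exact: add_continuous.
apply: cvgM.
- apply: (@continuous_comp _ _ _ fst (fun r => rmx r i k)); first exact: cvg_fst.
  exact: rmx_entry_continuous.
- apply: (@continuous_comp _ _ _ snd (fun r => rmx r k j)); first exact: cvg_snd.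
  exact: rmx_entry_continuous.
Qed.

Lemma SOV_continuous : continuous (fun r => r^-1%g).
Proof.
apply: SO_continuous => i j.
have -> : (fun r => rmx r^-1%g i j) = (fun r => rmx r j i).
  by apply/funext => r; rewrite [LHS]mxE.
exact: rmx_entry_continuous.
Qed.

Lemma SOM_measurable :
  measurable_fun setT (fun rs : SO R d * SO R d => (rs.1 * rs.2)%g).
Proof.
exact: continuous_prod_measurable (@SO_second_countable R d) SOM_continuous.
Qed.

Lemma SOV_measurable : measurable_fun setT (fun r => r^-1%g).
Proof. exact: continuous_Borel_measurable SOV_continuous. Qed.

Lemma eucl_norm_le_sum n (x : 'cV[R]_n) : eucl_norm x <= \sum_i `|x i 0|.
Proof.
have S0 : 0 <= \sum_i `|x i 0| by exact: sumr_ge0.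
rewrite -(@ler_pXn2r _ 2)// ?nnegrE ?eucl_norm_ge0// eucl_norm_sqr.
rewrite expr2 mulr_suml ler_sum// => i _.
rewrite -real_normK ?num_real// expr2 ler_wpM2l//.
by rewrite (bigD1 i)//= lerDl sumr_ge0.
Qed.

(** Entries of a unit vector have absolute value at most 1. The bound is uniform in [x], so it
    carries over to the Hausdorff distance of rotated sets. *)
Lemma eucl_dist_rot_le r s (x : 'cV[R]_d.+1) : sphere x ->
  eucl_dist (rmx r *m x) (rmx s *m x) <=
  \sum_i \sum_j `|rmx r i j - rmx s i j|.
Proof.
move=> x1; rewrite /eucl_dist -mulmxBl.
apply: le_trans (eucl_norm_le_sum _) _; apply: ler_sum => i _.
rewrite mxE; apply: le_trans (ler_norm_sum _ _ _) _; apply: ler_sum => j _.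
rewrite !mxE normrM ler_piMr// -x1; exact: le_coord_eucl_norm.
Qed.

Lemma hausdorff_dist_le C D m :
  (forall x, carrier C x -> exists2 y, carrier D y & eucl_dist x y <= m) ->
  (forall y, carrier D y -> exists2 x, carrier C x & eucl_dist y x <= m) ->
  hausdorff_dist C D <= m.
Proof.
move=> CD DC; rewrite /hausdorff_dist ge_max; apply/andP; split.
  by apply: sup_dist_to_ge => x /CD[y Dy]; exact/le_trans/dist_to_le.
by apply: sup_dist_to_ge => y /DC[x Cx]; exact/le_trans/dist_to_le.
Qed.

Lemma hausdorff_dist_rot_le r s C :
  hausdorff_dist (rot_set r C) (rot_set s C) <=
  \sum_i \sum_j `|rmx r i j - rmx s i j|.
Proof.
have [_ _ CS] := carrierP C.
apply: hausdorff_dist_le => _ [x Cx <-].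
  by exists (rmx s *m x); [exists x|exact/eucl_dist_rot_le/CS].
by exists (rmx r *m x); [exists x|rewrite eucl_distC; exact/eucl_dist_rot_le/CS].
Qed.

Lemma hausdorff_dist_rot r C D :
  hausdorff_dist (rot_set r C) (rot_set r D) <= hausdorff_dist C D.
Proof.
have rotE x y : eucl_dist (rmx r *m x) (rmx r *m y) = eucl_dist x y.
  by rewrite /eucl_dist -mulmxBr eucl_norm_rot.
have aux E F x : carrier E x ->
    dist_to (rmx r *m x) (carrier (rot_set r F)) <= hausdorff_dist E F.
  move=> Ex; apply: le_trans (dist_to_le_hausdorff F Ex).
  apply: dist_to_ge => y Fy; rewrite -(rotE x y); apply: dist_to_le.
  by exists y.
rewrite {1}/hausdorff_dist ge_max; apply/andP; split.
  by apply: sup_dist_to_ge => _ [x Cx <-]; exact: aux.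
by apply: sup_dist_to_ge => _ [x Dx <-]; rewrite hausdorff_distC; exact: aux.
Qed.

(** Compare [r C] and [s D] through [s C]: the first distance is bounded by the entries of [r - s],
    uniformly in [C]; the second is at most the distance from [C] to [D], as rotations are
    isometries. *)
Lemma rot_set_continuous :
  continuous (fun rC : SO R d * Cd R d => rot_set rC.1 rC.2).
Proof.
move=> [r C] /=; apply/cvg_ballP => e e0.
have e2 : 0 < e / 2 by rewrite divr_gt0.
pose f s := \sum_i \sum_j `|rmx r i j - rmx s i j|.
have cf : continuous f.
  move=> s.
  apply: (@cvg_big _ _ _ _ _ add_continuous _ _ _ _ _ (nbhs_filter s)) => i _.
  apply: (@cvg_big _ _ _ _ _ add_continuous _ _ _ _ _ (nbhs_filter s)) => j _.
  apply: (@cvg_norm _ _ _ (nbhs s) (nbhs_filter s)).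
  apply: (@cvgB _ _ _ _ (nbhs_filter s)).
    exact: (@cvg_cst _ _ _ (nbhs s) (nbhs_filter s)).
  exact: rmx_entry_continuous.
have fr : f r = 0.
  by rewrite /f big1// => i _; rewrite big1// => j _; rewrite subrr normr0.
exists ([set s | f s < e / 2], [set D | hausdorff_dist C D < e / 2]).
  split=> /=; last exact: (nbhsx_ballx C (e / 2) e2).
  by apply: (@cvgr_lt _ _ _ (nbhs_filter r) _ _ (cf r)); rewrite fr.
move=> [s D] /= [fs CD].
have -> : ball (rot_set r C) e (rot_set s D) =
  (hausdorff_dist (rot_set r C) (rot_set s D) < e) by [].
apply: le_lt_trans (hausdorff_dist_triangle (rot_set s C) _ _) _.
rewrite [e]splitr ltrD//.
  exact: le_lt_trans (hausdorff_dist_rot_le _ _ _) fs.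
exact: le_lt_trans (hausdorff_dist_rot _ _ _) CD.
Qed.

Lemma rot_set_measurable :
  measurable_fun setT (fun rC : SO R d * Cd R d => rot_set rC.1 rC.2).
Proof.
exact: continuous_prod_measurable (@SO_second_countable R d) rot_set_continuous.
Qed.

End rotation_group_topology.

(** * Rotations act transitively on the sphere *)

Section rotation_actions.
Context {R : realType} {d : nat}.
Implicit Types (r s : SO R d) (C : Cd R d) (x : sphereo R d).

Lemma rot_set1 C : rot_set 1%g C = C.
Proof.
apply: carrier_inj; rewrite [LHS](_ : _ = (fun y => 1%:M *m y) @` carrier C)//.
under eq_imagel do rewrite mul1mx.
exact: image_id.
Qed.

Lemma rot_setM r s C : rot_set (r * s)%g C = rot_set r (rot_set s C).
Proof.
apply: carrier_inj.
rewrite [RHS](_ : _ = (fun y => rmx r *m y) @`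
  ((fun y => rmx s *m y) @` carrier C))//.
rewrite [LHS](_ : _ = (fun y => (rmx r *m rmx s) *m y) @` carrier C)//.
by rewrite image_comp; apply: eq_imagel => y _; rewrite -mulmxA.
Qed.

Lemma rot_setK r : cancel (rot_set r) (rot_set r^-1%g).
Proof. by move=> C; rewrite -rot_setM mulVg rot_set1. Qed.

Lemma rot_setVK r : cancel (rot_set r^-1%g) (rot_set r).
Proof. by move=> C; rewrite -rot_setM mulgV rot_set1. Qed.

Lemma rot_pt1 x : rot_pt 1%g x = x.
Proof. by apply: val_inj; exact: mul1mx. Qed.

Lemma rot_ptM r s x : rot_pt (r * s)%g x = rot_pt r (rot_pt s x).
Proof. by apply: val_inj; rewrite /= mulmxA. Qed.

Lemma rot_ptK r : cancel (rot_pt r) (rot_pt r^-1%g).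
Proof. by move=> x; rewrite -rot_ptM mulVg rot_pt1. Qed.

Lemma rot_ptVK r : cancel (rot_pt r^-1%g) (rot_pt r).
Proof. by move=> x; rewrite -rot_ptM mulgV rot_pt1. Qed.

Lemma rot_pt_origin r : rot_pt r (origin R d) = origin R d.
Proof. by apply: val_inj; rewrite /= mulmx0. Qed.

Lemma sphere_rot_pt r x : sphere (vec x) -> sphere (vec (rot_pt r x)).
Proof. by rewrite /sphere/= eucl_norm_rot. Qed.

Lemma sphereoP x : sphere (vec x) \/ x = origin R d.
Proof.
have [|/= x0] := set_mem (valP x); first by left.
by right; apply: val_inj.
Qed.

Lemma sphere_neq_origin x : sphere (vec x) -> x <> origin R d.
Proof.
move=> + x0; rewrite x0 /sphere/= vec_origin eucl_norm0 => /eqP.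
by rewrite eq_sym oner_eq0.
Qed.

(** Invariance is stated with images, whereas measurability and Fubini arguments call for
    preimages. *)
Lemma image_rot_set r (A : set (Cd R d)) :
  [set rot_set r C | C in A] = rot_set r^-1%g @^-1` A.
Proof.
apply/seteqP; split=> [_ [C AC <-]|C /= AC]; first by rewrite /preimage/= rot_setK.
by exists (rot_set r^-1%g C) => //; rewrite rot_setVK.
Qed.

Lemma image_SOM r (B : set (SO R d)) :
  [set (r * s)%g | s in B] = (fun s => (r^-1 * s)%g) @^-1` B.
Proof.
apply/seteqP; split=> [_ [s Bs <-]|s /= Bs]; first by rewrite /preimage/= mulKg.
by exists (r^-1 * s)%g => //; rewrite mulVKg.
Qed.

End rotation_actions.

(** * Hyperplane reflections *)

Section reflections.
Context {R : realType} {n : nat}.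
Implicit Types u v w : 'cV[R]_n.

Definition sqnorm v : R := (v^T *m v) 0 0.

Lemma sqnormE v : sqnorm v = eucl_norm v ^+ 2.
Proof.
by rewrite eucl_norm_sqr /sqnorm mxE; apply: eq_bigr => i _; rewrite mxE expr2.
Qed.

Lemma sqnorm_eq0 v : (sqnorm v == 0) = (v == 0).
Proof.
rewrite sqnormE sqrf_eq0; apply/eqP/eqP => [/eucl_norm_eq0//|->].
exact: eucl_norm0.
Qed.

(* Since [0^-1 = 0], [reflection 0] is the identity. *)
Definition reflection v : 'M[R]_n := 1%:M - (2 / sqnorm v) *: (v *m v^T).

Lemma reflection_sym v : (reflection v)^T = reflection v.
Proof. by rewrite /reflection linearB linearZ/= trmx1 trmx_mul trmxK. Qed.

(** With [P = v v^T] one has [P P = |v|^2 P], so the quadratic term [c^2 P P] cancels [2 c P]. *)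
Lemma reflectionK v : reflection v *m reflection v = 1%:M.
Proof.
have [v0|v0] := eqVneq v 0.
  by rewrite /reflection v0 mul0mx scaler0 subr0 mul1mx.
have q0 : sqnorm v != 0 by rewrite sqnorm_eq0.
set c := 2 / sqnorm v; set P := v *m v^T.
have PP : P *m P = sqnorm v *: P.
  by rewrite mulmxA -(mulmxA v) [v^T *m v]mx11_scalar mul_mx_scalar -scalemxAl.
have cq : c * c * sqnorm v = c + c.
  by rewrite -mulrA [c * sqnorm v]mulfVK// mulr_natr.
rewrite /reflection -/c -/P mulmxBl mul1mx mulmxBr mulmx1 -scalemxAl -scalemxAr.
by rewrite PP !scalerA cq scalerDl opprB addrK subrK.
Qed.

(** Equal norms give [(u - v)^T u = |u - v|^2 / 2], so the reflection subtracts exactly [u - v] from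
    [u]. *)
Lemma reflection_swap u v : eucl_norm u = eucl_norm v ->
  reflection (u - v) *m u = v.
Proof.
move=> uv; have [uv0|uv0] := eqVneq (u - v) 0.
  rewrite uv0 /reflection mul0mx scaler0 subr0 mul1mx.
  by apply/eqP; rewrite -subr_eq0 uv0.
have q0 : sqnorm (u - v) != 0 by rewrite sqnorm_eq0.
have uvE : (u - v)^T *m u = (sqnorm (u - v) / 2)%:M.
  rewrite [LHS]mx11_scalar; congr (_%:M).
  have uvs : (u^T *m v) 0 0 = (v^T *m u) 0 0.
    by rewrite -[in RHS](trmxK u) -trmx_mul [RHS]mxE.
  have := sqnormE u; rewrite uv -sqnormE /sqnorm => uuvv.
  have mxB (A B : 'M[R]_1) : (A - B) 0 0 = A 0 0 - B 0 0 by rewrite !mxE.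
  by rewrite /sqnorm linearB/= mulmxBr !mulmxBl !mxB uvs uuvv; lra.
rewrite mulmxBl mul1mx -scalemxAl -mulmxA uvE mul_mx_scalar scalerA.
have -> : 2 / sqnorm (u - v) * (sqnorm (u - v) / 2) = 1.
  by field; rewrite q0.
by rewrite scale1r opprB addrC subrK.
Qed.

Lemma reflectionZ (c : R) v : c != 0 -> reflection (c *: v) = reflection v.
Proof.
move=> c0; congr (1%:M - _).
have -> : sqnorm (c *: v) = c * c * sqnorm v.
  by rewrite /sqnorm [(c *: v)^T]linearZ/= -scalemxAl -scalemxAr scalerA mxE.
rewrite [(c *: v)^T]linearZ/= -scalemxAl -scalemxAr !scalerA; congr (_ *: _).
(* For [sqnorm v = 0] both coefficients vanish by the convention [0^-1 = 0]. *)
have [->|v0] := eqVneq (sqnorm v) 0; first by rewrite mulr0 invr0 mulr0 !mul0r.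
by field; rewrite v0 c0.
Qed.

(* Both reflections are conjugate under [reflection (u - v)], so the common value
   of the determinant is not needed. *)
Lemma det_reflection u v : eucl_norm u = eucl_norm v ->
  \det (reflection u) = \det (reflection v).
Proof.
move=> uv; set U := reflection (u - v).
have UU : U *m U = 1%:M by exact: reflectionK.
have Uu : U *m u = v by exact: reflection_swap.
have uU : u^T *m U = v^T by rewrite -Uu trmx_mul reflection_sym.
have -> : reflection v = U *m reflection u *m U.
  clearbody U; rewrite /reflection mulmxBr mulmx1 mulmxBl UU -scalemxAr -scalemxAl.
  by rewrite mulmxA Uu -mulmxA uU !sqnormE uv.
have dUU : \det U * \det U = 1 by rewrite -det_mulmx UU det1.
by rewrite !det_mulmx mulrAC dUU mul1r.
Qed.

End reflections.

Section transitivity.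
Context {R : realType} {d : nat}.
Implicit Types (u v : 'cV[R]_d.+1) (x y p : sphereo R d).

Lemma eucl_normZ (c : R) u : eucl_norm (c *: u) = `|c| * eucl_norm u.
Proof.
rewrite /eucl_norm -sqrtr_sqr -sqrtrM ?sqr_ge0// mulr_sumr.
by congr Num.sqrt; apply: eq_bigr => i _; rewrite mxE exprMn.
Qed.

(** A reflection depends only on the line spanned by its vector, so both vectors may be
    normalised. *)
Lemma det_reflection_neq0 u v : u != 0 -> v != 0 ->
  \det (reflection u) = \det (reflection v).
Proof.
have neq0 w : w != 0 -> eucl_norm w != 0.
  by apply: contra => /eqP/eucl_norm_eq0 ->.
move=> /neq0 u0 /neq0 v0.
rewrite -(reflectionZ u (invr_neq0 u0)) -(reflectionZ v (invr_neq0 v0)).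
apply: det_reflection.
by rewrite !eucl_normZ !ger0_norm ?invr_ge0 ?eucl_norm_ge0// !mulVf.
Qed.

(* The product of the reflections along [p] and [p + x] maps [p] to [-p] and
   then to [x]. *)
Lemma rotation_of_neq_opp p x : sphere (vec p) -> sphere (vec x) ->
  vec x != - vec p -> exists r : SO R d, rot_pt r p = x.
Proof.
move=> p1 x1 xp; pose q := - vec p - vec x.
have q0 : q != 0 by rewrite subr_eq0 eq_sym.
have p0 : vec p != 0.
  by apply/eqP => p0; apply: (sphere_neq_origin p1); exact: val_inj.
have rP : reflection q *m reflection (vec p) \in @is_rotation R d.
  apply/mem_set; split.
    by rewrite trmx_mul !reflection_sym mulmxA -(mulmxA _ _ (reflection q))
      reflectionK mulmx1 reflectionK.
  by rewrite det_mulmx (det_reflection_neq0 q0 p0) -det_mulmx reflectionK det1.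
exists (in_set_type rP); apply: val_inj => /=; rewrite -mulmxA.
(* Since [2 p = p - (- p)], the reflection along [p] is the one that swaps [p] and [- p]. *)
have -> : reflection (vec p) *m vec p = - vec p.
  have <- : reflection (2 *: vec p) = reflection (vec p).
    by apply: reflectionZ; rewrite pnatr_eq0.
  have -> : 2 *: vec p = vec p - - vec p by rewrite scaler_nat mulr2n opprK.
  by apply: reflection_swap; rewrite eucl_normN.
by apply: reflection_swap; rewrite eucl_normN [LHS]p1 [RHS]x1.
Qed.

(** The antipode of [p] is reached in two moves. This takes a second dimension: for [d = 0] the
    rotation group is trivial. *)
Lemma sphere_transitive p x : (0 < d)%N -> sphere (vec p) -> sphere (vec x) ->
  exists r : SO R d, rot_pt r p = x.
Proof.
move=> d0 p1 x1; have [xp|] := eqVneq (vec x) (- vec p); last first.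
  exact: rotation_of_neq_opp.
have e1 i : sphere (delta_mx i 0 : 'cV[R]_d.+1).
  rewrite /sphere/= /eucl_norm (bigD1 i)//= mxE !eqxx expr1n big1 ?addr0.
    exact: sqrtr1.
  by move=> j ji; rewrite mxE (negbTE ji) expr0n.
have eS i : delta_mx i 0 \in (@sphere R d `|` [set 0]).
  by apply/mem_set; left.
(* A basis vector other than [p] and [-p] serves as an intermediate stop. *)
have [i [ip iNp]] : exists i : 'I_d.+1,
    delta_mx i 0 != vec p /\ delta_mx i 0 != - vec p.
  (* The vectors are told apart by coordinate 0: it is 1 for the first basis vector and, because
     [0 < d], 0 for the last one. *)
  have [p00|p0] := eqVneq (vec p ord0 0) 0.
    exists ord0; split; apply/eqP => /matrixP/(_ ord0 0)/eqP;
      by rewrite !mxE ?p00 ?oppr0 !eqxx/= oner_eq0.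
  have m0 : (ord0 == ord_max :> 'I_d.+1) = false by rewrite -val_eqE/= ltn_eqF.
  exists ord_max; split; apply/eqP => /matrixP/(_ ord0 0)/eqP;
    by rewrite !mxE m0/= 1?eq_sym ?oppr_eq0 (negbTE p0).
pose y : sphereo R d := in_set_type (eS i).
have y1 : sphere (vec y) by exact: e1.
have [r rp] := rotation_of_neq_opp p1 y1 iNp.
have [s sy] : exists s : SO R d, rot_pt s y = x.
  by apply: rotation_of_neq_opp => //; rewrite xp eqr_opp eq_sym.
by exists (s * r)%g; rewrite rot_ptM rp.
Qed.

End transitivity.

(** * Mixtures of probability kernels *)

Section kpull.
Context d1 d2 d3 (X : measurableType d1) (Y : measurableType d2)
  (Z : measurableType d3) (R : realType).
Variables (k : R.-pker Y ~> Z) (f : X -> Y).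

(** Keeping the proof [mf] in the term lets the kernel structures below attach to it. *)
Definition kpull (mf : measurable_fun setT f) (x : X) :
  {measure set Z -> \bar R} := k (f x).

Hypothesis mf : measurable_fun setT f.

Let kpull_measurable U : measurable U -> measurable_fun setT (kpull mf ^~ U).
Proof. by move=> mU; exact: measurableT_comp (measurable_kernel k U mU) mf. Qed.

HB.instance Definition _ := isKernel.Build _ _ X Z R (kpull mf) kpull_measurable.

Let kpull_prob x : kpull mf x setT = 1%E.
Proof. exact: prob_kernel. Qed.

HB.instance Definition _ :=
  Kernel_isProbability.Build _ _ X Z R (kpull mf) kpull_prob.

End kpull.

Section kpush.
Context d1 d2 d3 (X : measurableType d1) (Y : measurableType d2)
  (Z : measurableType d3) (R : realType).
Variables (k : R.-pker X ~> Y) (f : X * Y -> Z).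

Let msec (mf : measurable_fun setT f) x : measurable_fun setT (fun y => f (x, y)).
Proof. exact: measurableT_comp mf (pair1_measurable x). Qed.

(** The image of [k x] under the section [f (x, -)]. The measure structure of the pushforward is
    named explicitly so that it can be given the measurability of this section. *)
Definition kpush (mf : measurable_fun setT f) (x : X) :
    {measure set Z -> \bar R} :=
  measure_function_pushforward__canonical__measure_function_Measure
    (k x) (msec mf x).

Hypothesis mf : measurable_fun setT f.

Lemma kpushE x A : kpush mf x A = k x [set y | A (f (x, y))].
Proof. by []. Qed.

Let kpush_measurable U : measurable U -> measurable_fun setT (kpush mf ^~ U).
Proof.
move=> mU.
have mfU : (f @^-1` U) \in measurable.
  by rewrite inE -[X in measurable X]setTI; exact: mf.
rewrite [X in measurable_fun _ X](_ : _ = fun x => k x (xsection (f @^-1` U) x)).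
  exact: (measurable_fun_xsection_finite_kernel k mfU).
by apply/funext => x; rewrite kpushE; congr (k x _); apply/seteqP; split => y /=;
  rewrite /xsection/= inE.
Qed.

HB.instance Definition _ := isKernel.Build _ _ X Z R (kpush mf) kpush_measurable.

Let kpush_prob x : kpush mf x setT = 1%E.
Proof. by rewrite kpushE -[RHS](prob_kernel (s := k) x). Qed.

HB.instance Definition _ :=
  Kernel_isProbability.Build _ _ X Z R (kpush mf) kpush_prob.

Lemma integral_kpush x (g : Z -> \bar R) : measurable_fun setT g ->
  (forall z, 0 <= g z)%E ->
  (\int[kpush mf x]_z g z = \int[k x]_y g (f (x, y)))%E.
Proof.
move=> mg g0; have := @ge0_integral_pushforward _ _ _ _ _ _ (msec mf x) (k x) setT g.
by rewrite preimage_setT; apply.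
Qed.

End kpush.

Section mixture.
Context d1 d2 (X : measurableType d1) (Z : measurableType d2) (R : realType).
Variables (P : probability X R) (k : R.-pker X ~> Z).

Let mP : measurable_fun [set: unit] (fun=> (P : pprobability X R)).
Proof. exact: measurable_cst. Qed.

Let msnd : measurable_fun [set: unit * X] snd.
Proof. exact: measurable_snd. Qed.

(** Written as a composition of kernels starting from the one-point space [unit], so that the
    measure axioms and the integration formula are those of kernel composition. *)
Definition mixture : set Z -> \bar R :=
  mkcomp (kprobability mP) (kpull k msnd) tt.

Lemma mixtureE A : mixture A = (\int[P]_x k x A)%E.
Proof. by []. Qed.

HB.instance Definition _ := Measure.on mixture.

Let mixture_setT : mixture setT = 1%E.
Proof.
rewrite mixtureE; under eq_integral do rewrite prob_kernel.
by rewrite integral_cst// mul1e; exact: probability_setT.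
Qed.

HB.instance Definition _ := Measure_isProbability.Build _ _ R mixture mixture_setT.

Lemma integral_mixture (g : Z -> \bar R) : measurable_fun setT g ->
  (forall z, 0 <= g z)%E ->
  (\int[mixture]_z g z = \int[P]_x \int[k x]_z g z)%E.
Proof.
move=> mg g0.
exact: (integral_kcomp (kprobability mP) (kpull k msnd) tt g0 mg).
Qed.

End mixture.

Lemma integral_ae_eq_nonneg d (T : measurableType d) (R : realType)
    (mu : {measure set T -> \bar R}) (N : set T) (f g : T -> \bar R) :
  measurable N -> mu N = 0%E ->
  measurable_fun setT f -> measurable_fun setT g ->
  (forall x, ~ N x -> f x = g x) ->
  (\int[mu]_x f x = \int[mu]_x g x)%E.
Proof.
move=> mN N0 mf mg fg; apply: ae_eq_integral => //.
exists N; split => // x /= nfg; apply: contrapT => Nx; apply: nfg => _.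
exact: fg.
Qed.

Section indicator_sections.
Context d1 d2 (X : measurableType d1) (Y : measurableType d2) (R : realType).

Lemma integral_indic_fun (mu : {measure set X -> \bar R}) (f : X -> Y) A :
  measurable_fun setT f -> measurable A ->
  (\int[mu]_x (\1_A (f x))%:E = mu [set x | A (f x)])%E.
Proof.
move=> mf mA; have mfA : measurable (f @^-1` A).
  by rewrite -[X in measurable X]setTI; exact: mf.
by have := @integral_indic _ _ _ mu setT measurableT _ mfA; rewrite setIT.
Qed.

End indicator_sections.

Section fubini_preimage.
Context d1 d2 d3 (X : measurableType d1) (Y : measurableType d2)
  (Z : measurableType d3) (R : realType).
Variables (mu : {sfinite_measure set X -> \bar R})
  (nu : {sfinite_measure set Y -> \bar R}).

(** The form in which averages over rotations and over sets are exchanged in the rest of the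
    proof. *)
Lemma fubini_preimage (f : X * Y -> Z) A : measurable_fun setT f ->
  measurable A ->
  (\int[mu]_x nu [set y | A (f (x, y))] = \int[nu]_y mu [set x | A (f (x, y))])%E.
Proof.
move=> mf mA.
have fx x : measurable_fun setT (fun y => f (x, y)).
  exact: measurableT_comp mf (pair1_measurable x).
have fy y : measurable_fun setT (fun x => f (x, y)).
  exact: measurableT_comp mf (pair2_measurable y).
transitivity (\int[mu]_x \int[nu]_y (\1_A (f (x, y)))%:E)%E.
  by apply: eq_integral => x _; rewrite integral_indic_fun.
rewrite (sfinite_Fubini mu nu (fun xy => (\1_A (f xy))%:E)) //.
- by apply: eq_integral => y _; rewrite (integral_indic_fun mu (fy y)).
- by apply/measurable_EFinP; apply: measurableT_comp mf; exact: measurable_indic.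
Qed.

End fubini_preimage.

Section kernel_values.
Context d1 d2 d3 (X : measurableType d1) (Y : measurableType d2)
  (Z : measurableType d3) (R : realType).

(** A name for [k x] that can carry the structure of a probability. *)
Definition pker_at (k : R.-pker X ~> Y) (x : X) : set Y -> \bar R := k x.

HB.instance Definition _ k x := Measure.on (pker_at k x).
HB.instance Definition _ k x :=
  Measure_isProbability.Build _ _ R (pker_at k x) (prob_kernel (s := k) x).

Let mconst (P : probability Y R) :
  measurable_fun [set: X] (fun=> (P : pprobability Y R)).
Proof. exact: measurable_cst. Qed.

Definition kconst (P : probability Y R) : R.-pker X ~> Y :=
  kprobability (mconst P).

Lemma measurable_kernel_preimage (k : R.-pker X ~> Y) (f : X * Y -> Z) A :
  measurable_fun setT f -> measurable A ->
  measurable_fun setT (fun x => k x [set y | A (f (x, y))]).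
Proof. by move=> mf mA; exact: (measurable_kernel (kpush k mf) A mA). Qed.

End kernel_values.

(** * Unimodularity *)

Section invariant_probabilities.
Context {R : realType} {d : nat}.
Variables (nu : probability (SO R d) R) (G : set (SO R d)).
Hypotheses (mG : measurable G)
  (nuG : nu G = 1%E) (nuL : left_invariant G nu).

Lemma left_invariantE r (B : set (SO R d)) : G r -> measurable B ->
  nu [set s : SO R d | B (r^-1 * s)%g] = nu B.
Proof. by move=> Gr mB; rewrite -[RHS](nuL Gr mB) image_SOM. Qed.

Let nuGC : nu (~` G) = 0%E.
Proof. by rewrite probability_setC// nuG subee. Qed.

Let measurable_preV (B : set (SO R d)) : measurable B ->
  measurable [set r : SO R d | B r^-1%g].
Proof.
by move=> mB; rewrite -[X in measurable X]setTI; exact: SOV_measurable.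
Qed.

Let mVM : measurable_fun setT (fun rs : SO R d * SO R d => (rs.1^-1 * rs.2)%g).
Proof.
have mg : measurable_fun setT (fun rs : SO R d * SO R d => (rs.1^-1%g, rs.2)).
  apply: measurable_fun_pair => //.
  exact: measurableT_comp SOV_measurable measurable_fst.
exact: measurableT_comp SOM_measurable mg.
Qed.

(* Integrating [B (r^-1 s)] over [s] first gives [nu B], over [r] first it gives
   [nu (B^-1)]. *)
Lemma left_invariantV (B : set (SO R d)) : measurable B ->
  nu [set r : SO R d | B r^-1%g] = nu B.
Proof.
move=> mB; have mBV := measurable_preV mB.
(* As [nu] lives on [G], a function that is constant on [G] integrates to that constant. *)
have cstE (f : SO R d -> \bar R) c : measurable_fun setT f ->
    (forall r, G r -> f r = c) -> (\int[nu]_r f r = c)%E.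
  move=> mf fc; rewrite (@integral_ae_eq_nonneg _ _ _ nu (~` G) _ (cst c)) //.
  - by rewrite integral_cst// -[RHS]mule1; congr (_ * _)%E; exact: probability_setT.
  - exact: measurableC.
  - by move=> r /contrapT; exact: fc.
rewrite -[RHS](cstE _ _ (measurable_kernel_preimage (kconst _ nu) mVM mB)); last first.
  by move=> r Gr; exact: left_invariantE.
rewrite [RHS](fubini_preimage nu nu mVM mB); apply/esym/cstE => [|s Gs].
  exact: (measurable_kernel_preimage (kconst _ nu)
    (measurableT_comp mVM (@measurable_swap _ _ _ _)) mB).
(* [r^-1 s] is the inverse of [s^-1 r], so for fixed [s] the set is a left translate of the inverse
   of [B]. *)
rewrite -[RHS](left_invariantE Gs mBV).
by congr (nu _); apply/funext => r /=; rewrite invgM invgK.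
Qed.

(** Inversion turns right translations into left ones. *)
Lemma left_invariant_right r (B : set (SO R d)) : G r -> measurable B ->
  nu [set s : SO R d | B (s * r)%g] = nu B.
Proof.
move=> Gr mB; have mBr : measurable [set s : SO R d | B (s * r)%g].
  rewrite -[X in measurable X]setTI.
  exact: (measurableT_comp SOM_measurable (pair2_measurable r)).
rewrite -(left_invariantV mBr) -[RHS](left_invariantV mB).
rewrite -[RHS](left_invariantE Gr (measurable_preV mB)).
by congr (nu _); apply/funext => s /=; rewrite invgM invgK.
Qed.

End invariant_probabilities.

(** * The centred shape distribution *)

Section centred_shape.
Context {R : realType} {d : nat}.
Variables (d0 : (0 < d)%N) (p : sphereo R d) (p1 : sphere (vec p)).
Variables (lambda : probability (SO R d) R) (hlambda : is_haar lambda).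
Variables (kappa : R.-pker (sphereo R d) ~> (SO R d)).
Hypothesis hkappa : is_kappa p lambda kappa.
Implicit Types (x : sphereo R d) (r s : SO R d) (C : Cd R d).

Lemma measurable_sphereo1 x : measurable [set x].
Proof.
have -> : [set x] = ~` (@vec R d @^-1` (~` [set vec x])).
  apply/seteqP; split=> [y -> /=|y /= /contrapT]; first exact.
  exact: val_inj.
apply: measurableC; apply: sub_sigma_algebra.
exists (~` [set vec x]) => //; rewrite openC.
exact: accessible_closed_set1 (hausdorff_accessible (@norm_hausdorff _ _)) _.
Qed.

Lemma rot_pt_measurable x : measurable_fun setT (fun r => rot_pt r x).
Proof.
apply: continuous_Borel_measurable; apply: continuous_comp_initial.
apply: mx_continuous => i j.
suff : continuous (fun r => vec (rot_pt r x) i j) by [].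
have -> : (fun r => vec (rot_pt r x) i j) =
    (fun r => \sum_k rmx r i k * vec x k j).
  by apply/funext => r; rewrite [LHS]mxE.
move=> r; apply: (@cvg_big _ _ _ _ _ add_continuous _ _ _ _ _ (nbhs_filter r)) => k _.
apply: (@cvgMr_tmp _ _ (nbhs r) (nbhs_filter r)); exact: rmx_entry_continuous.
Qed.

(** For [x] on the sphere this is a left coset of the stabilizer of [p]; for [x = p] it is
    convertible to [stabilizer p]. *)
Definition transporters x : set (SO R d) := [set r | rot_pt r p = x].

Lemma measurable_transporters x : measurable (transporters x).
Proof.
rewrite -[X in measurable X]setTI.
exact: rot_pt_measurable (measurable_sphereo1 x).
Qed.

Lemma kappa_shift r x (B : set (SO R d)) : measurable B -> rot_pt r p = x ->
  kappa x B = kappa p [set s : SO R d | B (r * s)%g].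
Proof.
move=> mB rpx; have [_ kx _] := hkappa.
rewrite (kx _ _ _ rpx)//; last by rewrite -rpx; exact: sphere_rot_pt.
rewrite (integral_indic_fun _ _ mB)//.
exact: measurableT_comp SOM_measurable (pair1_measurable r).
Qed.

Lemma kappa_origin (B : set (SO R d)) : measurable B ->
  kappa (origin R d) B = lambda B.
Proof. by case: hkappa => _ _; apply. Qed.

(** [kappa x] is the image of [kappa p] under left translation by some [r] with [r p = x], and this
    translation takes the stabilizer of [p] to the coset. *)
Lemma kappa_transporters x : sphere (vec x) -> kappa x (~` transporters x) = 0%E.
Proof.
move=> x1; have [r rpx] := sphere_transitive d0 p1 x1.
have E := probability_setC (pker_at kappa x) (measurable_transporters x).
rewrite [LHS]E [X in (_ - X)%E](_ : _ = 1%E) ?subee// {E}.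
rewrite [LHS](kappa_shift (measurable_transporters x) rpx).
have [[<- _] _ _] := hkappa; congr (kappa p _); apply/seteqP.
rewrite /transporters -rpx; split=> s /=; rewrite rot_ptM.
  exact: can_inj (rot_ptK r) _ _.
by move=> ->.
Qed.

(** The left translation that produces [kappa x] commutes with right multiplication by [s], which
    leaves the claim for [kappa p]; at the origin the kernel is [lambda]. *)
Lemma kappa_right x s (B : set (SO R d)) : rot_pt s p = p -> measurable B ->
  kappa x [set r : SO R d | B (r * s)%g] = kappa x B.
Proof.
move=> sp mB.
have mBs : measurable [set r : SO R d | B (r * s)%g].
  rewrite -[X in measurable X]setTI.
  exact: (measurableT_comp SOM_measurable (pair2_measurable s)).
have [x1|->] := sphereoP x; last first.
  rewrite !kappa_origin//; apply: (@left_invariant_right _ _ _ setT) => //.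
  exact: probability_setT.
have [r rpx] := sphere_transitive d0 p1 x1.
rewrite !(kappa_shift _ rpx)//.
have mBr : measurable [set t : SO R d | B (r * t)%g].
  rewrite -[X in measurable X]setTI.
  exact: (measurableT_comp SOM_measurable (pair1_measurable r)).
have [[kS kL] _ _] := hkappa.
have mK := measurable_transporters p.
have E := @left_invariant_right _ _ (pker_at kappa p) _ mK kS kL _ _ sp mBr.
by rewrite -[RHS]E; congr (kappa p _); apply/funext => t /=; rewrite mulgA.
Qed.


(** * Spreading and centring a compact set *)

Variables (cs : Cd R d -> sphereo R d) (hcs : centre_function cs).

Let mcs : measurable_fun setT cs := hcs.1.

Let mrot : measurable_fun setT (fun Cr : Cd R d * SO R d => rot_set Cr.2 Cr.1).
Proof. exact: measurableT_comp rot_set_measurable (@measurable_swap _ _ _ _). Qed.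

Let mrotV :
  measurable_fun setT (fun Cr : Cd R d * SO R d => rot_set Cr.2^-1%g Cr.1).
Proof.
have mg : measurable_fun setT (fun Cr : Cd R d * SO R d => (Cr.2^-1%g, Cr.1)).
  apply: measurable_fun_pair => //.
  exact: measurableT_comp SOV_measurable measurable_snd.
exact: measurableT_comp rot_set_measurable mg.
Qed.

Definition spread : R.-pker (Cd R d) ~> (Cd R d) :=
  kpush (kconst _ lambda) mrot.

Definition centring : R.-pker (Cd R d) ~> (Cd R d) :=
  kpush (kpull kappa mcs) mrotV.

Lemma spreadE C A : spread C A = lambda [set r | A (rot_set r C)].
Proof. by []. Qed.

Lemma centringE C A : centring C A = kappa (cs C) [set r | A (rot_set r^-1%g C)].
Proof. by []. Qed.

Lemma measurable_spread_set C (A : set (Cd R d)) : measurable A ->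
  measurable [set r | A (rot_set r C)].
Proof.
move=> mA; rewrite -[X in measurable X]setTI.
exact: (measurableT_comp mrot (pair1_measurable C)).
Qed.

Lemma measurable_centring_set C (A : set (Cd R d)) : measurable A ->
  measurable [set r : SO R d | A (rot_set r^-1%g C)].
Proof.
move=> mA; rewrite -[X in measurable X]setTI.
exact: (measurableT_comp mrotV (pair1_measurable C)).
Qed.

Lemma measurable_rot_set r : measurable_fun setT (rot_set r).
Proof. exact: (measurableT_comp rot_set_measurable (pair1_measurable r)). Qed.

Lemma measurable_image_rot_set r (A : set (Cd R d)) : measurable A ->
  measurable [set rot_set r C | C in A].
Proof.
move=> mA; rewrite image_rot_set -[X in measurable X]setTI.
exact: measurable_rot_set.
Qed.

Lemma measurable_Cd_at x : measurable (Cd_at cs x).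
Proof. by rewrite -[X in measurable X]setTI; exact: mcs (measurable_sphereo1 x). Qed.

Lemma cs_rot r C : cs (rot_set r C) = rot_pt r (cs C).
Proof. by case: hcs. Qed.

(** By right invariance of [lambda], the spread law depends only on the orbit of the set. *)
Lemma spread_rot r C (A : set (Cd R d)) : measurable A ->
  spread (rot_set r C) A = spread C A.
Proof.
move=> mA; rewrite !spreadE.
rewrite -[RHS](@left_invariant_right _ _ lambda setT _ _ _ r)//; first last.
- exact: measurable_spread_set.
- exact: probability_setT.
by congr (lambda _); apply/funext => s /=; rewrite rot_setM.
Qed.

Lemma rot_invariantE (nu : set (Cd R d) -> \bar R) G r (A : set (Cd R d)) :
  rot_invariant G nu -> G r -> measurable A ->
  nu [set C | A (rot_set r^-1%g C)] = nu A.
Proof. by move=> nuG Gr mA; rewrite -[RHS](nuG _ Gr _ mA) image_rot_set. Qed.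

(** Invariance is asked for the single set [A], so that the lemma also serves a law known to be
    invariant only on the sets centred at the origin. *)
Lemma integral_spread (nu : probability (Cd R d) R) (A : set (Cd R d)) :
  measurable A -> (forall r, nu [set C | A (rot_set r C)] = nu A) ->
  (\int[nu]_C spread C A = nu A)%E.
Proof.
move=> mA nuA; rewrite (fubini_preimage nu lambda mrot mA).
rewrite (eq_integral (cst (nu A))); last by move=> r _; exact: nuA.
rewrite integral_cst// -[RHS]mule1; congr (_ * _)%E; exact: probability_setT.
Qed.

Lemma rot_invariantVE (nu : set (Cd R d) -> \bar R) r (A : set (Cd R d)) :
  rot_invariant setT nu -> measurable A -> nu [set C | A (rot_set r C)] = nu A.
Proof.
by move=> nuI mA; rewrite -[RHS](rot_invariantE (r := r^-1%g) nuI)//= invgK.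
Qed.

(** Equivariance of [cs]: a rotation fixing [x] permutes the sets with centre [x]. *)
Lemma image_rot_set_Cd_at r x (A : set (Cd R d)) : rot_pt r x = x ->
  [set rot_set r C | C in A] `&` Cd_at cs x =
  [set rot_set r C | C in A `&` Cd_at cs x].
Proof.
move=> rx; rewrite !image_rot_set; apply/seteqP; rewrite /Cd_at.
split=> C /= [AC]; rewrite cs_rot => Cx; split=> //.
  by rewrite Cx -{1}rx rot_ptK.
by rewrite -(rot_ptVK r (cs C)) Cx.
Qed.

(** Almost every [r] takes [p] to [cs C], so [r^-1 C] has centre [p]; a centre at the origin is kept
    by every rotation. *)
Lemma centring_concentrated C :
  centring C (~` (Cd_at cs (origin R d) `|` Cd_at cs p)) = 0%E.
Proof.
rewrite centringE; have [x1|x0] := sphereoP (cs C).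
  apply: subset_measure0 (kappa_transporters x1).
  - apply: measurable_centring_set; apply: measurableC.
    by apply: measurableU; exact: measurable_Cd_at.
  - by apply: measurableC; exact: measurable_transporters.
  - by move=> r /= + rp; apply; right; rewrite /Cd_at/= cs_rot -rp rot_ptK.
rewrite [X in kappa _ X](_ : _ = set0) ?measure0//.
apply/seteqP; split=> // r /=; apply; left.
by rewrite /Cd_at/= cs_rot x0 rot_pt_origin.
Qed.

(** If [cs C] lies on the sphere, no rotated copy of [C] is centred at the origin and both sides
    vanish. *)
Lemma centring_at_origin C (A : set (Cd R d)) : measurable A ->
  A `<=` Cd_at cs (origin R d) ->
  centring C A = lambda [set r : SO R d | A (rot_set r^-1%g C)].
Proof.
move=> mA Ao; rewrite centringE; have [x1|x0] := sphereoP (cs C).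
  have -> : [set r : SO R d | A (rot_set r^-1%g C)] = set0.
    apply/seteqP; split=> // r /= /Ao; rewrite /Cd_at/= cs_rot => rC.
    by apply: (sphere_neq_origin x1); rewrite -(rot_ptVK r (cs C)) rC rot_pt_origin.
  by rewrite !measure0.
by rewrite x0 kappa_origin//; exact: measurable_centring_set.
Qed.

(** Since [s^-1 r^-1 = (r s)^-1], rotating [A] by [s] amounts to multiplying [r] by [s] on the
    right. *)
Lemma centring_right s C (A : set (Cd R d)) : rot_pt s p = p -> measurable A ->
  centring C [set rot_set s D | D in A] = centring C A.
Proof.
move=> sp mA; rewrite image_rot_set !centringE -[RHS](kappa_right _ sp).
  by congr (kappa _ _); apply/funext => r /=; rewrite -rot_setM invgM.
exact: measurable_centring_set.
Qed.

(** [kappa (s p)] is the law of [s r] for [r] distributed according to [kappa p], and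
    [(s r)^-1 (s C) = r^-1 C]. *)
Lemma centring_at_p s C (A : set (Cd R d)) : cs C = p -> measurable A ->
  centring (rot_set s C) A = kappa p [set r : SO R d | A (rot_set r^-1%g C)].
Proof.
move=> Cp mA; rewrite centringE cs_rot Cp.
rewrite (kappa_shift (measurable_centring_set _ mA) (erefl _)).
by congr (kappa p _); apply/funext => r /=; rewrite -rot_setM invgM mulgVK.
Qed.

(** * The centred law of an invariant probability *)

Section representation.
Variables (P : probability (Cd R d) R) (hP : rot_invariant setT P).

Local Notation Co := (Cd_at cs (origin R d)).
Local Notation Cp := (Cd_at cs p).

Let CoCp : Co `&` Cp = set0.
Proof.
apply/seteqP; split=> // C []; rewrite /Cd_at/= => ->.
by move/esym/(sphere_neq_origin p1).
Qed.

Definition shape_law : probability (Cd R d) R := mixture P centring.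

Lemma shape_lawE A : shape_law A = (\int[P]_C centring C A)%E.
Proof. by []. Qed.

Lemma shape_concentrated : shape_law (~` (Co `|` Cp)) = 0%E.
Proof.
by rewrite shape_lawE (eq_integral (cst 0%E)) ?integral0// => C _;
  exact: centring_concentrated.
Qed.

(** On such sets centring is a uniformly random rotation, under which [P] is invariant. *)
Lemma shape_at_origin (A : set (Cd R d)) : measurable A -> A `<=` Co ->
  shape_law A = P A.
Proof.
move=> mA Ao; rewrite shape_lawE.
rewrite (eq_integral _ _ (fun C _ => centring_at_origin C mA Ao)).
rewrite (fubini_preimage P lambda mrotV mA).
rewrite (eq_integral (cst (P A))); last first.
  by move=> r _; rewrite -[RHS](rot_invariantE (r := r) hP).
rewrite integral_cst// -[RHS]mule1; congr (_ * _)%E; exact: probability_setT.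
Qed.

Lemma shape_invariant_origin : rot_invariant setT (restriction shape_law Co).
Proof.
move=> r _ A mA; rewrite /restriction.
have mAo : measurable (A `&` Co) by apply: measurableI => //; exact: measurable_Cd_at.
rewrite image_rot_set_Cd_at ?rot_pt_origin// !shape_at_origin//; first exact: hP.
  exact: measurable_image_rot_set.
by move=> _ [C [_ C0] <-]; rewrite /Cd_at/= cs_rot C0 rot_pt_origin.
Qed.

Lemma shape_invariant_p : rot_invariant (stabilizer p) (restriction shape_law Cp).
Proof.
move=> r rp A mA; rewrite /restriction.
have mAp : measurable (A `&` Cp) by apply: measurableI => //; exact: measurable_Cd_at.
rewrite image_rot_set_Cd_at// !shape_lawE.
by apply: eq_integral => C _; exact: centring_right.
Qed.

Lemma shape_representation (A : set (Cd R d)) : measurable A ->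
  P A = (\int[shape_law]_C spread C A)%E.
Proof.
move=> mA; rewrite integral_mixture//; last exact: measurable_kernel.
(* Once [P A] is itself an average of [spread C A] over [P], the integrands can be compared for each
   [C]. *)
rewrite -(integral_spread mA); last by move=> r; exact: rot_invariantVE.
apply: eq_integral => C _.
rewrite integral_kpush//; last exact: measurable_kernel.
rewrite (eq_integral (cst (spread C A))); last first.
  by move=> r _; rewrite spread_rot.
by rewrite integral_cst// -[LHS]mule1; congr (_ * _)%E; exact/esym/prob_kernel.
Qed.

(** * Uniqueness of the centred law *)

Section uniqueness.
Variable Q : probability (Cd R d) R.
Hypotheses (QC : Q (~` (Co `|` Cp)) = 0%E)
  (Qo : rot_invariant setT (restriction Q Co))
  (Qp : rot_invariant (stabilizer p) (restriction Q Cp))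
  (QP : forall A, measurable A -> P A = (\int[Q]_C spread C A)%E).

(** The sets centred at the origin are permuted by all rotations and [Q] is invariant there, so
    spreading does not change [Q] on them. *)
Lemma unique_at_origin (A : set (Cd R d)) : measurable A ->
  Q (A `&` Co) = P (A `&` Co).
Proof.
move=> mA; have mAo : measurable (A `&` Co).
  by apply: measurableI => //; exact: measurable_Cd_at.
rewrite QP// integral_spread// => r.
have := rot_invariantVE r Qo mA; rewrite /restriction => <-.
congr (Q _); apply/seteqP; rewrite /Cd_at; split=> C /= [AC].
  rewrite cs_rot => rC; split=> //.
  by rewrite -(rot_ptK r (cs C)) rC rot_pt_origin.
by rewrite cs_rot => ->; rewrite rot_pt_origin.
Qed.

Lemma unique_at_p (A : set (Cd R d)) : measurable A ->
  Q (A `&` Cp) = shape_law (A `&` Cp).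
Proof.
move=> mA; set A' := A `&` Cp; have mA' : measurable A'.
  by apply: measurableI => //; exact: measurable_Cd_at.
have mf := measurable_kernel centring A' mA'.
have mg := measurable_kernel_preimage (kconst _ (pker_at kappa p)) mrotV mA'.
(* By [QP], [P] is the mixture over [Q] of the spread laws. *)
rewrite shape_lawE (eq_measure_integral (mixture Q spread)); last first.
  by move=> B mB _; exact: QP.
rewrite integral_mixture//.
(* The intermediate term is the average of [Q (r A')] over [kappa p]. It equals [Q A'], since almost
   every [r] fixes [p] and [Q] is invariant under such [r] on the sets centred at [p]. *)
transitivity (\int[Q]_C pker_at kappa p [set r : SO R d | A' (rot_set r^-1%g C)])%E.
  rewrite (fubini_preimage Q (pker_at kappa p) mrotV mA').
  rewrite (@integral_ae_eq_nonneg _ _ _ _ (~` stabilizer p) _ (cst (Q A'))) //.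
  - rewrite integral_cst// -[LHS]mule1; congr (_ * _)%E.
    exact/esym/probability_setT.
  - by apply: measurableC; exact: measurable_transporters.
  - exact: kappa_transporters.
  - exact: (measurable_kernel_preimage (kconst _ Q)
      (measurableT_comp mrotV (@measurable_swap _ _ _ _)) mA').
  - move=> r /contrapT rp; have := rot_invariantE Qp rp mA.
    rewrite /restriction /cst => <-; congr (Q _); apply/seteqP.
    rewrite /A' /Cd_at; split=> C /= [AC]; rewrite ?cs_rot => Cp'; split=> //.
      by rewrite -(rot_ptVK r (cs C)) Cp'.
    by rewrite Cp' -{1}rp rot_ptK.
(* For [Q]-almost every [C], centred at the origin or at [p], the inner integrand does not depend on
   the rotation [s]. *)
apply: (@integral_ae_eq_nonneg _ _ _ _ (~` (Co `|` Cp))) => //.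
- by apply: measurableC; apply: measurableU; exact: measurable_Cd_at.
- apply: (measurable_fun_integral_finite_kernel
    (fun xy => centring xy.2 A') spread) => //.
  exact: measurableT_comp mf measurable_snd.
move=> C /contrapT CC.
rewrite integral_kpush//.
have fE s : centring (rot_set s C) A' =
    pker_at kappa p [set r : SO R d | A' (rot_set r^-1%g C)].
  case: CC => [C0|Cp']; last exact: centring_at_p.
  (* A set centred at the origin never gets centre [p] by rotation, so both sides are zero for
     it. *)
  have A'0 r D : cs D = origin R d -> ~ A' (rot_set r D).
    move=> D0 [_]; rewrite /Cd_at/= cs_rot D0 rot_pt_origin.
    by move/esym/(sphere_neq_origin p1).
  have -> : [set r : SO R d | A' (rot_set r^-1%g C)] = set0.
    by apply/seteqP; split=> // r; exact: A'0.
  rewrite centringE [X in kappa _ X](_ : _ = set0) ?measure0//.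
  apply/seteqP; split=> // r; apply: A'0.
  by rewrite cs_rot C0 rot_pt_origin.
rewrite (eq_integral _ _ (fun s _ => fE s)).
rewrite integral_cst// -[LHS]mule1; congr (_ * _)%E.
exact/esym/probability_setT.
Qed.

(** Both laws live on the disjoint sets [Co] and [Cp], so agreement on each of them suffices. *)
Lemma shape_unique (A : set (Cd R d)) : measurable A -> Q A = shape_law A.
Proof.
have split (mu : probability (Cd R d) R) B : mu (~` (Co `|` Cp)) = 0%E ->
    measurable B -> mu B = (mu (B `&` Co) + mu (B `&` Cp))%E.
  move=> mu0 mB; have mCo := measurable_Cd_at (origin R d).
  have mCp := measurable_Cd_at p.
  rewrite -measureU; [|exact: measurableI|exact: measurableI|]; last first.
    by rewrite setIACA CoCp setI0.
  have mCop : measurable (Co `|` Cp) by exact: measurableU.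
  rewrite -setIUr [LHS](measureDI mu mB mCop).
  rewrite [X in (X + _)%E](_ : _ = 0%E) ?add0e//.
  apply: subset_measure0 mu0; [exact: measurableD|exact: measurableC|].
  by move=> C [].
move=> mA; rewrite !(split _ A)//; last exact: shape_concentrated.
rewrite unique_at_origin// unique_at_p//.
rewrite [in RHS](shape_at_origin (A := A `&` Co))//.
by apply: measurableI => //; exact: measurable_Cd_at.
Qed.

End uniqueness.

End representation.

End centred_shape.

Theorem theorem9p1 (R : realType) (d : nat) (hd : (2 <= d)%N)
    (p : sphereo R d) (hp : sphere (vec p))
    (lambda : probability (SO R d) R) (hlambda : is_haar lambda)
    (kappa : R.-pker (sphereo R d) ~> (SO R d))
    (hkappa : is_kappa p lambda kappa)
    (cs : Cd R d -> sphereo R d) (hcs : centre_function cs)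
    (Lambda : {finite_measure set (Cd R d) -> \bar R})
    (hLambda : rot_invariant setT Lambda)
    (gamma : R) (hgamma : Lambda setT = gamma%:E) (hgamma0 : 0 < gamma) :
  exists Q : probability (Cd R d) R,
    [/\ is_centred_shape p lambda cs Lambda gamma Q,
        forall Q' : probability (Cd R d) R,
          is_centred_shape p lambda cs Lambda gamma Q' ->
          forall A : set (Cd R d), measurable A -> Q' A = Q A
      & forall A : set (Cd R d), measurable A ->
          Q A = ((gamma^-1)%:E *
            \int[Lambda]_C \int[kappa (cs C)]_r (\1_A (rot_set (r^-1)%g C))%:E)%E].
Proof.
have d0 : (0 < d)%N by exact: ltnW.
(* [dirac point] is the default of [mnormalize] for total mass zero or infinity, which [hgamma] and
   [hgamma0] exclude. *)
pose P : probability (Cd R d) R := mnormalize Lambda (dirac point).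
have PE A : P A = ((gamma^-1)%:E * Lambda A)%E.
  rewrite /P/= /mnormalize/= hgamma eqe (gt_eqF hgamma0)/=.
  by rewrite muleC.
have LE A : Lambda A = (gamma%:E * P A)%E.
  by rewrite PE muleA -EFinM mulfV ?mul1e// gt_eqF.
have hP : rot_invariant setT P.
  by move=> r rT A mA; rewrite !PE hLambda.
pose Q := shape_law kappa hcs P.
have spreadI (nu : probability (Cd R d) R) (A : set (Cd R d)) : measurable A ->
    (\int[nu]_C \int[lambda]_r (\1_A (rot_set r C))%:E)%E =
    (\int[nu]_C spread lambda C A)%E.
  move=> mA; apply: eq_integral => C _; rewrite integral_indic_fun//.
  exact: measurableT_comp rot_set_measurable (pair2_measurable C).
exists Q; split.
- split.
  + exact: (shape_concentrated d0 hp hkappa).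
  + exact: (shape_invariant_origin hkappa).
  + exact: (shape_invariant_p d0 hp hlambda hkappa).
  + by move=> A mA; rewrite LE spreadI// -(shape_representation hlambda).
- move=> Q' [Q'C Q'o Q'p Q'L] A mA; apply: (shape_unique d0 hp hkappa) => // B mB.
  by rewrite PE Q'L// spreadI// muleA -EFinM mulVf ?mul1e// gt_eqF.
- move=> A mA; rewrite [LHS]shape_lawE.
  have g0 : 0 <= gamma^-1 by rewrite invr_ge0 ltW.
  (* The measure [P] is replaced by the scaled measure [gamma^-1 Lambda], so that the factor can
     leave the integral. *)
  pose PL := mscale (NngNum g0) Lambda.
  rewrite (eq_measure_integral PL); last by move=> B mB _; rewrite [LHS]PE.
  rewrite ge0_integral_mscale//; last first.
    exact: (measurable_kernel (centring kappa hcs) A mA).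
  congr (_ * _)%E; apply: eq_integral => C _; rewrite integral_indic_fun//.
  have mrC := measurableT_comp rot_set_measurable (pair2_measurable C).
  exact: measurableT_comp mrC SOV_measurable.
Qed.
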